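(* Let $\mathfrak g=\mathfrak{sl}_n$, let $\mu$ be a partition of $n$ and $\mathbf e=(e_1,e_2)$ the principal nilpotent pair associated with $\mu$. Then the orbit $T\cdot\mathbf e$ is dense in $(\mathfrak g_{1,0}\oplus\mathfrak g_{0,1})\cap\mathfrak C$.
   Context: Let $V$ be an $n$-dimensional vector space with basis $v_{i,j}$ indexed by the boxes $(i,j)$ ($i,j\ge0$; $i$ the row, $j$ the column) of the Young diagram of $\mu$; put $v_{i,j}=0$ if $(i,j)$ is outside the diagram. The pair is $e_1v_{i,j}=v_{i+1,j}$, $e_2v_{i,j}=v_{i,j+1}$. The associated semisimple pair $(h_1,h_2)$ is given, up to scalar matrices, by $h_1v_{i,j}=i\,v_{i,j}$, $h_2v_{i,j}=j\,v_{i,j}$, and $\mathfrak g_{p,q}=\{x\in\mathfrak g:[h_1,x]=px,[h_2,x]=qx\}$. Thus $\mathfrak g_{1,0}$ (resp. $\mathfrak g_{0,1}$) consists of the operators sending each $v_{i,j}$ to a multiple of $v_{i+1,j}$ (resp. $v_{i,j+1}$). $\mathfrak C\subset\mathfrak g\times\mathfrak g$ is the commuting variety, $\mathfrak g_{1,0}\oplus\mathfrak g_{0,1}$ is regarded as the subspace $\mathfrak g_{1,0}\times\mathfrak g_{0,1}$ of $\mathfrak g\times\mathfrak g$, and $T\subset SL_n$ is the maximal torus of operators diagonal in the basis $v_{i,j}$, acting by simultaneous conjugation. *)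

(* Defs.v *)
From HB Require Import structures.
From mathcomp Require Import all_boot all_order all_algebra.
From mathcomp Require Import classical_sets.
From mathcomp Require Import mpoly.

Set Implicit Arguments.
Unset Strict Implicit.
Unset Printing Implicit Defensive.

Import GRing.Theory.
Local Open Scope classical_set_scope.
Local Open Scope ring_scope.

Definition is_partition (n : nat) (mu : seq nat) : bool :=
  [&& sorted geq mu, 0%N \notin mu & sumn mu == n].

(* Row by row; this list has no repetition and has size sumn mu. *)
Definition boxes (mu : seq nat) : seq (nat * nat) :=
  [seq (i, j) | i <- iota 0 (size mu), j <- iota 0 (nth 0%N mu i)].

Definition box (mu : seq nat) (k : nat) : nat * nat :=
  nth (0%N, 0%N) (boxes mu) k.

Section Pair.
Variables (F : fieldType) (n : nat) (mu : seq nat).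

(* When mu is a partition of n, the vectors [vbox i j] with (i, j) in the
   diagram are, up to order, the standard basis of F^n, and [vbox i j = 0] otherwise.
   Operators are matrices acting on column vectors. *)
Definition vbox (i j : nat) : 'cV[F]_n := \col_k (box mu k == (i, j))%:R.

Definition e1 : 'M[F]_n :=
  \matrix_(k, l) vbox (box mu l).1.+1 (box mu l).2 k 0.
Definition e2 : 'M[F]_n :=
  \matrix_(k, l) vbox (box mu l).1 (box mu l).2.+1 k 0.
Definition nilpair : 'M[F]_n * 'M[F]_n := (e1, e2).

(* The representative in sl_n of x modulo scalar matrices, in characteristic 0. *)
Definition traceless (x : 'M[F]_n) : 'M[F]_n := x - (\tr x / n%:R)%:M.

Definition h1 : 'M[F]_n := traceless (diag_mx (\row_k (box mu k).1%:R)).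
Definition h2 : 'M[F]_n := traceless (diag_mx (\row_k (box mu k).2%:R)).

Definition sl : set 'M[F]_n := [set x | \tr x = 0].

Definition bracket (x y : 'M[F]_n) : 'M[F]_n := x *m y - y *m x.

Definition sl_graded (p q : F) : set 'M[F]_n :=
  [set x | [/\ sl x, bracket h1 x = p *: x & bracket h2 x = q *: x]].

Definition commuting_variety : set ('M[F]_n * 'M[F]_n) :=
  [set x | [/\ sl x.1, sl x.2 & bracket x.1 x.2 = 0]].

Definition torus : set 'M[F]_n := [set t | is_diag_mx t /\ \det t = 1].

Definition conj_pair (t : 'M[F]_n) (x : 'M[F]_n * 'M[F]_n) :
    'M[F]_n * 'M[F]_n :=
  (t *m x.1 *m invmx t, t *m x.2 *m invmx t).

Definition torus_orbit (x : 'M[F]_n * 'M[F]_n) : set ('M[F]_n * 'M[F]_n) :=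
  [set conj_pair t x | t in torus].

End Pair.

Arguments vbox F n mu i j : clear implicits.
Arguments e1 F n mu : clear implicits.
Arguments e2 F n mu : clear implicits.
Arguments nilpair F n mu : clear implicits.
Arguments h1 F n mu : clear implicits.
Arguments h2 F n mu : clear implicits.
Arguments sl_graded F n mu p q : clear implicits.
Arguments commuting_variety F n : clear implicits.

Section Zariski.
Variables (F : fieldType) (n : nat).
Implicit Types (A B Z : set ('M[F]_n * 'M[F]_n)).

Definition pair_coords (x : 'M[F]_n * 'M[F]_n) (k : 'I_(n * n + n * n)) : F :=
  row_mx (mxvec x.1) (mxvec x.2) 0 k.

Definition zariski_closed Z : Prop :=
  exists S : set {mpoly F[n * n + n * n]},
    Z = [set x | forall P, S P -> P.@[pair_coords x] = 0].

Definition zariski_closure A : set ('M[F]_n * 'M[F]_n) :=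
  \bigcap_(Z in [set Z | zariski_closed Z /\ A `<=` Z]) Z.

(* The closure of A in the subspace B is the trace on B of the closure. *)
Definition zariski_dense_in A B : Prop :=
  A `<=` B /\ B `<=` zariski_closure A.

End Zariski.

(* Main.v *)
Require Import Defs.
From mathcomp Require Import all_boot all_order all_algebra.
From mathcomp Require Import classical_sets.
From mathcomp Require Import zify ring.
From mathcomp Require Import mpoly.

(** A point of the right-hand side is a family of scalars on the edges of the
    grid graph of mu, with opposite paths of every unit square having equal
    products.  The heart of the matter is that then, along every closed walk,
    the product over the edges traversed forwards equals the product over the
    edges traversed backwards, even when some scalars vanish.  This gives a
    potential g on boxes whose ratios are the nonzero scalars, and, since no
    closed walk can use a zero edge forwards and only nonzero edges backwards,
    an integer height phi which is constant along nonzero edges and strictly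
    increases along zero edges.  Conjugating the nilpotent pair by the torus
    element diag (g s^phi) and letting s tend to 0 yields the given point; a
    polynomial vanishing for all s <> 0 on this curve also vanishes at s = 0. *)

Set Implicit Arguments.
Unset Strict Implicit.
Unset Printing Implicit Defensive.

Import GRing.Theory.
Local Open Scope classical_set_scope.
Local Open Scope ring_scope.

(** * Closed walks *)

Section Walks.
Variable R : comNzRingType.

Definition walk_prod (T : Type) (f : T -> T -> R) (t : T) (p : seq T) : R :=
  \prod_(c <- pairmap f t p) c.

Lemma walk_prod_cons T (f : T -> T -> R) (t x : T) (p : seq T) :
  walk_prod f t (x :: p) = f t x * walk_prod f x p.
Proof. exact: big_cons. Qed.

Lemma walk_prod_cat T (f : T -> T -> R) (t : T) (p q : seq T) :
  walk_prod f t (p ++ q) = walk_prod f t p * walk_prod f (last t p) q.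
Proof. by rewrite /walk_prod pairmap_cat big_cat. Qed.

(** A closed walk may start anywhere, the product being commutative. Cutting at [y] brings it to the
    head; moving the last step [x] in front then leaves [y] with two known predecessors, [t'] and
    [x]. *)
Lemma closed_walk_rot (T : eqType) (e : rel T) (t y : T) (p : seq T) :
    path e t p -> last t p = t -> y \in p -> (1 < size p)%N ->
  exists t' x q,
    [/\ path e t' (x :: y :: q), last t' (x :: y :: q) = t',
        perm_eq (x :: y :: q) p &
        forall f : T -> T -> R, walk_prod f t' (x :: y :: q) = walk_prod f t p].
Proof.
have rot t1 p1 p2 : path e t1 (p1 ++ p2) -> last t1 (p1 ++ p2) = t1 ->
    [/\ path e (last t1 p1) (p2 ++ p1), last (last t1 p1) (p2 ++ p1) = last t1 p1,
        perm_eq (p2 ++ p1) (p1 ++ p2) & forall f : T -> T -> R,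
    walk_prod f (last t1 p1) (p2 ++ p1) = walk_prod f t1 (p1 ++ p2)].
  rewrite cat_path last_cat => /andP[e1 e2] l; split=> [|||f].
  - by rewrite cat_path e2 l e1.
  - by rewrite last_cat l.
  - by rewrite perm_catC.
  - by rewrite !walk_prod_cat l mulrC.
move=> ep lp yp; case/splitPr: yp ep lp => p1 p2 ep lp sz.
have [ep' lp' pp fp] := rot _ _ _ ep lp; move: ep' lp' pp fp.
set t' := last t p1; rewrite cat_cons.
case/lastP E: (p2 ++ p1) => [|q x] ep' lp' pp fp.
  by move: (perm_size pp); rewrite -(perm_size pp) in sz.
rewrite -cats1 -cat_cons in ep' lp' pp fp.
have [ep2 lp2 pp2 fp2] := rot _ _ _ ep' lp'.
exists (last t' (y :: q)), x, q; split=> // [|f].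
  exact: perm_trans pp.
by rewrite -fp -fp2.
Qed.

End Walks.

(** * Transport along monotone paths in a commuting grid *)

Section CommutingGrid.
Variables (R : comNzRingType) (a b : nat -> nat -> R).
Hypothesis grid_comm : forall i j, a i j * b i.+1 j = b i j * a i j.+1.
Implicit Types (t u v w x y z : nat * nat) (p : seq (nat * nat)).

Definition lebox u v : bool := (u.1 <= v.1)%N && (u.2 <= v.2)%N.

Lemma lebox_trans v u w : lebox u v -> lebox v w -> lebox u w.
Proof. by rewrite /lebox; lia. Qed.

(* The product along any monotone path from u to v; the junk value 1 when
   u is not below v makes backward steps neutral in products over walks. *)
Definition transport u v : R :=
  if lebox u v then
    (\prod_(u.1 <= r < v.1) a r u.2) * \prod_(u.2 <= s < v.2) b v.1 s
  else 1.

Lemma column_shift i k j : (i <= k)%N ->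
  (\prod_(i <= r < k) a r j) * b k j = b i j * \prod_(i <= r < k) a r j.+1.
Proof.
move=> /subnKC <-; elim: (k - i)%N => [|d IH].
  by rewrite addn0 !big_geq // mul1r mulr1.
rewrite addnS !big_nat_recr ?leq_addr //= -mulrA grid_comm mulrA IH.
by rewrite -!mulrA.
Qed.

Lemma column_row_swap i k j l : (i <= k)%N -> (j <= l)%N ->
  (\prod_(i <= r < k) a r j) * \prod_(j <= s < l) b k s =
  (\prod_(j <= s < l) b i s) * \prod_(i <= r < k) a r l.
Proof.
move=> ik /subnKC <-; elim: (l - j)%N => [|d IH].
  by rewrite addn0 !(@big_geq _ _ _ j) // mul1r mulr1.
rewrite addnS !(@big_nat_recr _ _ _ (j + d)) ?leq_addr //=.
by rewrite mulrA IH -mulrA column_shift // mulrA.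
Qed.

(** Both sides go down, then right, except that the right-hand side detours along the other two
    sides of the rectangle with corners [(v.1, u.2)] and [(w.1, v.2)]; [column_row_swap] flips this
    rectangle. *)
Lemma transport_trans v u w : lebox u v -> lebox v w ->
  transport u w = transport u v * transport v w.
Proof.
move=> uv vw; rewrite /transport uv vw (lebox_trans uv vw).
case/andP: uv => uv1 uv2; case/andP: vw => vw1 vw2.
rewrite (big_cat_nat uv1 vw1) (big_cat_nat uv2 vw2) /=.
rewrite -!mulrA; congr (_ * _); rewrite !mulrA; congr (_ * _).
exact: column_row_swap.
Qed.

Lemma transport_down i j : transport (i, j) (i.+1, j) = a i j.
Proof.
by rewrite /transport /lebox /= leqnSn leqnn big_nat1 big_geq // mulr1.
Qed.

Lemma transport_right i j : transport (i, j) (i, j.+1) = b i j.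
Proof.
by rewrite /transport /lebox /= leqnSn leqnn big_nat1 big_geq // mul1r.
Qed.

Lemma transport_ge u v : lebox v u -> transport u v = 1.
Proof.
move=> vu; rewrite /transport; case: ifP => // uv.
have -> : u = v; last by rewrite !big_geq // mulr1.
by case: u v vu uv => [u1 u2] [v1 v2]; rewrite /lebox /= => *; congr pair; lia.
Qed.

Definition comparable_boxes u v := lebox u v || lebox v u.

Lemma comparable_boxesC u v : comparable_boxes u v = comparable_boxes v u.
Proof. exact: orbC. Qed.

(** Three pairwise comparable boxes form a chain, and [k] is the transport over the part of it
    covered both ways, or 1. As [k] is common to the forward and the backward product, nothing is
    cancelled and [k] may be 0. *)
Lemma transport_shortcut x y z :
    comparable_boxes x y -> comparable_boxes y z -> comparable_boxes x z ->
  exists k, transport x y * transport y z = k * transport x z /\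
            transport y x * transport z y = k * transport z x.
Proof.
have main x1 x2 x3 : lebox x1 x2 -> lebox x2 x3 -> [/\ transport x2 x1 = 1,
  transport x3 x2 = 1, transport x3 x1 = 1 &
  transport x1 x3 = transport x1 x2 * transport x2 x3].
  move=> x12 x23; have x13 := lebox_trans x12 x23.
  by split; [exact: transport_ge..|exact: transport_trans].
case/orP=> [xy|yx]; case/orP=> [yz|zy].
- case: (main _ _ _ xy yz) => -> -> -> -> _.
  by exists 1; split; ring.
- case/orP=> [xz|zx].
    case: (main _ _ _ xz zy) => -> -> -> -> .
    by exists (transport z y); split; ring.
  case: (main _ _ _ zx xy) => -> -> -> -> .
  by exists (transport x y); split; ring.
- case/orP=> [xz|zx].
    case: (main _ _ _ yx xz) => -> -> -> -> .
    by exists (transport y x); split; ring.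
  case: (main _ _ _ yz zx) => -> -> -> -> .
  by exists (transport y z); split; ring.
case: (main _ _ _ zy yx) => -> -> -> -> _.
by exists 1; split; ring.
Qed.

Lemma transport_shortcut2 t x y z :
    lebox t x -> lebox y x -> lebox y z -> lebox t z ->
  exists k, transport t x * (transport x y * transport y z) =
              k * transport t z /\
            transport x t * (transport y x * transport z y) =
              k * transport z t.
Proof.
(* The join [w] of [t] and [y] lies below both peaks [x] and [z], so all four transports factor
   through it. *)
move=> tx yx yz tz; pose w := (maxn t.1 y.1, maxn t.2 y.2).
have [tw yw] : lebox t w /\ lebox y w by rewrite /lebox /=; lia.
have [wx wz] : lebox w x /\ lebox w z.
  by move: tx yx yz tz; rewrite /lebox /=; lia.
rewrite (transport_ge tx) (transport_ge yx) (transport_ge yz) (transport_ge tz).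
rewrite (transport_trans tw wx) (transport_trans yw wx) (transport_trans yw wz).
rewrite (transport_trans tw wz).
by exists (transport w x * transport y w); split; ring.
Qed.

(* The interesting case is a zigzag t <= x >= y <= z >= u in which y, of least
   row index, is comparable with neither t nor u: both are then to its left, and
   the join with y of whichever has the smaller row is below both peaks. *)
Lemma lowest_row_cases t x y z u :
    comparable_boxes t x -> comparable_boxes x y ->
    comparable_boxes y z -> comparable_boxes z u ->
    (y.1 <= t.1)%N -> (y.1 <= x.1)%N -> (y.1 <= z.1)%N -> (y.1 <= u.1)%N ->
  [\/ comparable_boxes t y, comparable_boxes x z, comparable_boxes y u |
      [&& lebox t x, lebox y x, lebox y z & lebox t z] ||
      [&& lebox u z, lebox y z, lebox y x & lebox u x]].
Proof.
case: (boolP (comparable_boxes t y)) => [|nty]; first by constructor 1.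
case: (boolP (comparable_boxes x z)) => [|nxz]; first by constructor 2.
case: (boolP (comparable_boxes y u)) => [|nyu]; first by constructor 3.
move=> tx xy yz zu yt1 yx1 yz1 yu1; constructor 4.
move: nty nxz nyu tx xy yz zu yt1 yx1 yz1 yu1.
by rewrite /comparable_boxes /lebox; lia.
Qed.

(** Strong induction on the length: near a box of least row the walk can be shortened, with the same
    factor lost in both products. Allowing steps between any comparable boxes, not only neighbours,
    keeps the shortened walk in the same class. *)
Lemma closed_walk_transport t p :
    path comparable_boxes t p -> last t p = t ->
  walk_prod transport t p = walk_prod (fun u v => transport v u) t p.
Proof.
have [m] := ubnP (size p); elim: m t p => // m IH t p sp ep lp.
case: p sp ep lp => [|x0 [|x1 p0]] sp ep lp.
- by rewrite /walk_prod !big_nil.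
- by rewrite -lp.
set p := x0 :: x1 :: p0 in sp ep lp *.
have [y yp ymin] : exists2 y, y \in p & forall z, z \in p -> (y.1 <= z.1)%N.
  have ex : exists k, k \in [seq z.1 | z <- p] by exists x0.1; rewrite inE eqxx.
  case: (ex_minnP ex) => k /mapP[y yp ->] kmin.
  by exists y => // z zp; apply: kmin; apply: map_f.
have [t' [x [q [ep' lp' pp fp]]]] := closed_walk_rot R ep lp yp isT.
rewrite -!fp; move: (perm_size pp) => sq.
have {}ymin z : z \in x :: y :: q -> (y.1 <= z.1)%N.
  by rewrite (perm_mem pp); exact: ymin.
rewrite -sq in sp; move: ep' lp' ymin sp {sq fp pp yp ep lp p p0 x0 x1 t}.
(* Closed walks of two or three steps are settled directly; longer ones begin with four steps
   through [x], [y], [z], [u]. *)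
case: q => [|z [|u r]] ep lp ymin sp.
- by move: lp => /= yt; rewrite /walk_prod /= !big_cons !big_nil -yt; ring.
- move: ep lp; rewrite /= => /and4P[tx xy yz _] zt; subst z.
  rewrite comparable_boxesC in yz.
  have [k [fk bk]] := transport_shortcut tx xy yz.
  rewrite /walk_prod /= !big_cons !big_nil !mulrA fk bk; ring.
have {}ymin : [&& y.1 <= t'.1, y.1 <= x.1, y.1 <= z.1 & y.1 <= u.1]%N.
  have tr : t' \in [:: x, y, z, u & r].
    have := mem_last u r; rewrite (lp : last u r = t') => tr.
    by rewrite (in_cons x) (in_cons y) (in_cons z) tr !orbT.
  by rewrite !ymin // !inE eqxx ?orbT.
(* It suffices to replace the first four steps by at most three, through the boxes of [s], at the
   cost of a common factor [k]; the induction hypothesis does the rest. *)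
have step s : path comparable_boxes t' (s ++ u :: r) -> (size s < 3)%N ->
    (exists k, walk_prod transport t' [:: x; y; z; u] =
          k * walk_prod transport t' (s ++ [:: u]) /\
        walk_prod (fun v w => transport w v) t' [:: x; y; z; u] =
          k * walk_prod (fun v w => transport w v) t' (s ++ [:: u])) ->
    walk_prod transport t' [:: x, y, z, u & r] =
    walk_prod (fun v w => transport w v) t' [:: x, y, z, u & r].
  move=> es ss [k [fk bk]].
  have split3 f : walk_prod f t' [:: x, y, z, u & r] =
      walk_prod f t' [:: x; y; z; u] * walk_prod f u r.
    by rewrite -(walk_prod_cat f t' [:: x; y; z; u]).
  have splits f : walk_prod f t' (s ++ u :: r) =
      walk_prod f t' (s ++ [:: u]) * walk_prod f u r.
    by rewrite -cat_rcons walk_prod_cat last_rcons cats1.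
  rewrite !split3 fk bk -!mulrA -!splits IH //.
    move: sp; rewrite size_cat /= addnS ltnS => sp; apply: leq_trans sp.
    by rewrite !ltnS -[(size r).+2]add2n leq_add2r.
  by move: lp; rewrite last_cat.
move: ep; rewrite /= => /and5P[tx xy yz zu er].
case/and4P: ymin => yt1 yx1 yz1 yu1.
have shape f : walk_prod f t' [:: x; y; z; u] = f t' x * f x y * f y z * f z u.
  by rewrite /walk_prod /= !big_cons big_nil; ring.
have shape2 f v w : walk_prod f t' ([:: v; w] ++ [:: u]) = f t' v * f v w * f w u.
  by rewrite /walk_prod /= !big_cons big_nil; ring.
have shape1 f v : walk_prod f t' ([:: v] ++ [:: u]) = f t' v * f v u.
  by rewrite /walk_prod /= !big_cons big_nil; ring.
case: (lowest_row_cases tx xy yz zu yt1 yx1 yz1 yu1) => [ty|xz|yu|].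
- apply: (step [:: y; z]) => //=; first by rewrite ty yz zu.
  have [k [fk bk]] := transport_shortcut tx xy ty.
  by exists k; rewrite !shape !shape2 fk bk; split; ring.
- apply: (step [:: x; z]) => //=; first by rewrite tx xz zu.
  have [k [fk bk]] := transport_shortcut xy yz xz.
  exists k; rewrite !shape !shape2 -(mulrA _ (transport x y)) fk.
  by rewrite -(mulrA _ (transport y x)) bk; split; ring.
- apply: (step [:: x; y]) => //=; first by rewrite tx xy yu.
  have [k [fk bk]] := transport_shortcut yz zu yu.
  exists k; rewrite !shape !shape2 -(mulrA _ (transport y z)) fk.
  by rewrite -(mulrA _ (transport z y)) bk; split; ring.
case/orP=> /and4P[l1 l2 l3 l4].
  apply: (step [:: z]) => //=.
    by rewrite [comparable_boxes _ z]/comparable_boxes l4 zu.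
  have [k [fk bk]] := transport_shortcut2 l1 l2 l3 l4.
  exists k; rewrite !shape !shape1 -(mulrA _ (transport x y)) fk.
  by rewrite -(mulrA _ (transport y x)) bk; split; ring.
apply: (step [:: x]) => //=; first by rewrite tx /comparable_boxes l4 orbT.
(* This is the same zigzag read from [u] back to [x], so the forward and backward identities trade
   places. *)
have [k [fk bk]] := transport_shortcut2 l1 l2 l3 l4.
exists k; rewrite !shape !shape1; split.
  transitivity
    (transport t' x * (transport z u * (transport y z * transport x y))).
    by ring.
  by rewrite bk; ring.
transitivity
  (transport x t' * (transport u z * (transport z y * transport y x))).
  by ring.
by rewrite fk; ring.
Qed.

End CommutingGrid.

(** * Potential and height *)

Section Degeneration.
Variables (F : fieldType) (a b : nat -> nat -> F).
Hypothesis grid_comm : forall i j, a i j * b i.+1 j = b i j * a i j.+1.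
Variables (I : finType) (pos : I -> nat * nat).
Implicit Types (u v w : I) (p : seq I).

Definition covers u v : bool :=
  (pos v == ((pos u).1.+1, (pos u).2)) || (pos v == ((pos u).1, (pos u).2.+1)).

Definition weight u v : F := transport a b (pos u) (pos v).

Lemma covers_comparable u v :
  covers u v || covers v u -> comparable_boxes (pos u) (pos v).
Proof.
rewrite /comparable_boxes /lebox.
by case/orP=> /orP[] /eqP -> /=; rewrite !leqnn !leqnSn ?orbT.
Qed.

Lemma weight_coversC u v : covers u v -> weight v u = 1.
Proof.
by move=> uv; rewrite /weight /transport; case/orP: uv => /eqP-> ;
  rewrite /lebox /= ltnn ?andbF.
Qed.

Lemma walk_prod_map (f : nat * nat -> nat * nat -> F) u p :
  walk_prod f (pos u) (map pos p) = walk_prod (fun v w => f (pos v) (pos w)) u p.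
Proof.
by elim: p u => [|v p IH] u; rewrite ?walk_prod_cons ?IH // /walk_prod !big_nil.
Qed.

Lemma closed_walk_weight u p :
    path (fun v w => covers v w || covers w v) u p -> last u p = u ->
  walk_prod weight u p = walk_prod (fun v w => weight w v) u p.
Proof.
move=> up lu; rewrite -(walk_prod_map (transport a b)).
rewrite -(walk_prod_map (fun x y => transport a b y x)).
apply: closed_walk_transport => //; last by rewrite last_map lu.
by rewrite path_map; apply: sub_path up => v w; exact: covers_comparable.
Qed.

Lemma walk_prod_neq0 (e : rel I) (f : I -> I -> F) u p :
  (forall v w, e v w -> f v w != 0) -> path e u p -> walk_prod f u p != 0.
Proof.
move=> ef; elim: p u => [|v p IH] u; first by rewrite /walk_prod big_nil oner_eq0.
by rewrite walk_prod_cons /= => /andP[/ef uv /IH vp]; rewrite mulf_neq0.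
Qed.

Lemma walk_prod_div (f h : I -> I -> F) u p :
  walk_prod (fun v w => f v w / h v w) u p = walk_prod f u p / walk_prod h u p.
Proof.
elim: p u => [|v p IH] u; first by rewrite /walk_prod !big_nil invr1 mulr1.
by rewrite !walk_prod_cons IH invfM mulrACA.
Qed.

Definition live u v := covers u v && (weight u v != 0).
(** Edges of weight zero are one-way and live edges two-way, so that returning across a zero edge
    would produce a forbidden closed walk. *)
Definition flow u v := covers u v || live v u.
Definition height v := #|[pred w | connect flow w v]|.

Lemma height_homo u v : connect flow u v -> (height u <= height v)%N.
Proof.
move=> uv; rewrite /height; apply: subset_leq_card.
apply/fintype.subsetP => w; rewrite !inE => wu.
exact: connect_trans uv.
Qed.

Lemma height_live u v : live u v -> height u = height v.
Proof.
move=> uv; apply/eqP; rewrite eqn_leq !height_homo // connect1 // /flow.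
  by rewrite uv orbT.
by case/andP: uv => ->.
Qed.

(** A flow path from [v] back to [u] would close up with the zero edge. The forward product of that
    closed walk is 0, while its backward product only has factors 1 (covers) and nonzero weights
    (live edges). Hence [v] is counted in its own height but not in that of [u]. *)
Lemma height_dead u v : covers u v -> weight u v = 0 -> (height u < height v)%N.
Proof.
move=> uv w0; have uvf : connect flow u v by apply: connect1; rewrite /flow uv.
rewrite /height; apply: proper_card; apply/fintype.properP; split.
  by apply/fintype.subsetP => w; rewrite !inE => wu; apply: connect_trans uvf.
exists v; rewrite !inE ?connect0 //; apply/negP => /connectP[p vp lu].
have up : path flow u (v :: p) by rewrite /= vp /flow uv.
have := @closed_walk_weight u (v :: p) _ (esym lu).
rewrite walk_prod_cons w0 mul0r => H.
have /negP[] : walk_prod (fun v w => weight w v) u (v :: p) != 0.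
  apply: walk_prod_neq0 up => x y /orP[xy|/andP[_ ->//]].
  by rewrite weight_coversC // oner_eq0.
rewrite -H //; apply: sub_path up => x y /orP[-> //|/andP[-> _]]; exact: orbT.
Qed.

Definition live_sym u v := live u v || live v u.
(** On a live edge one of the two weights is 1: this is the edge scalar forwards and its inverse
    backwards. *)
Definition ratio u v := weight u v / weight v u.

Lemma closed_live_ratio u p :
  path live_sym u p -> last u p = u -> walk_prod ratio u p = 1.
Proof.
move=> up lu; rewrite walk_prod_div closed_walk_weight //.
  rewrite divff //; apply: walk_prod_neq0 up => x y.
  by case/orP=> /andP[xy w]; rewrite // weight_coversC ?oner_eq0.
by apply: sub_path up => x y /orP[]/andP[-> _]; rewrite ?orbT.
Qed.

(** The potential [g] multiplies ratios along a path from the root of the live component, and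
    [closed_live_ratio] makes the choice of path irrelevant. Since [0 ^+ 0] is 1, the power of 0 is
    the indicator of equal heights, written as the value at 0 of a monomial. *)
Lemma exists_degeneration : exists (g : I -> F) (phi : I -> nat),
  (forall v, g v != 0) /\
  forall u v, covers u v ->
    (phi u <= phi v)%N /\ weight u v * g u = g v * 0 ^+ (phi v - phi u).
Proof.
have sym : connect_sym live_sym by apply: sym_connect_sym => x y; exact: orbC.
have ex v : exists pq : seq I * seq I,
    [/\ path live_sym (fingraph.root live_sym v) pq.1,
        last (fingraph.root live_sym v) pq.1 = v,
        path live_sym v pq.2 & last v pq.2 = fingraph.root live_sym v].
  have vr := connect_root live_sym v.
  have /connectP[q ? ?] := vr; move: vr; rewrite sym => /connectP[p ? ?].
  by exists (p, q).
have [pq pqP] := fin_all_exists ex.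
pose g v := walk_prod ratio (fingraph.root live_sym v) (pq v).1.
have rneq x y : live_sym x y -> ratio x y != 0.
  move=> /orP[]/andP[xy w]; rewrite /ratio (weight_coversC xy) ?divr1 //.
  by rewrite mul1r invr_eq0.
exists g, height; split=> [v|u v uv].
  by apply: walk_prod_neq0 rneq _; case: (pqP v).
split; first by apply: height_homo; rewrite connect1 // /flow uv.
case: (eqVneq (weight u v) 0) => [w0|w0].
  have h := height_dead uv w0.
  by rewrite w0 mul0r expr0n subn_eq0 leqNgt h mulr0.
have uvl : live u v by rewrite /live uv.
rewrite (height_live uvl) subnn mulr1.
have [pu lu qu lqu] := pqP u; have [pv lv qv lqv] := pqP v.
have ruv : fingraph.root live_sym u = fingraph.root live_sym v.
  by apply/eqP; rewrite root_connect // connect1 // /live_sym uvl.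
(* The closed walks root, [u], [v], root and root, [v], root share their return path, whose nonzero
   product cancels. *)
have H1 : g u * (ratio u v * walk_prod ratio v (pq v).2) = 1.
  rewrite /g -walk_prod_cons -{3}lu -walk_prod_cat closed_live_ratio //.
    by rewrite cat_path pu lu /= qv /live_sym uvl.
  by rewrite last_cat lu /= lqv ruv.
have H2 : g v * walk_prod ratio v (pq v).2 = 1.
  rewrite /g -{3}lv -walk_prod_cat closed_live_ratio //.
    by rewrite cat_path pv lv qv.
  by rewrite last_cat lv lqv.
have -> : weight u v = ratio u v by rewrite /ratio (weight_coversC uv) // divr1.
have w2 : walk_prod ratio v (pq v).2 != 0 by apply: walk_prod_neq0 rneq qv.
by apply: (mulIf w2); rewrite H2 -H1; ring.
Qed.

End Degeneration.

(** * Degeneration along a monomial curve *)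

Section MonomialCurve.
Variables (F : fieldType) (charF : [pchar F] =i pred0).

Lemma natr_inj_char0 : injective (fun m : nat => m%:R : F).
Proof.
have natr_le i j : (i <= j)%N -> i%:R = j%:R :> F -> i = j.
  move=> ij e; apply/eqP; rewrite eqn_leq ij -subn_eq0 -((pcharf0P F).1 charF).
  by rewrite natrB // e subrr eqxx.
move=> i j e; case/orP: (leq_total i j) => ij; first exact: natr_le.
by apply/esym/natr_le.
Qed.

Lemma poly_eq0_off_origin (Q : {poly F}) :
  (forall s, s != 0 -> Q.[s] = 0) -> Q = 0.
Proof.
move=> Q0; apply/eqP; apply: contraT => nz.
(* In characteristic zero the integers from 1 to [size Q] are distinct and nonzero, which is more
   roots than the degree allows. *)
pose rs := [seq i.+1%:R : F | i <- iota 0 (size Q)].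
have := @max_poly_roots F Q rs nz; rewrite size_map size_iota ltnn; apply.
  apply/allP => s /mapP[i _ ->]; rewrite /root Q0 //.
  by rewrite ((pcharf0P F).1 charF).
by rewrite map_inj_uniq ?iota_uniq // => i j /natr_inj_char0[].
Qed.

Lemma meval_poly (N : nat) (P : {mpoly F[N]}) (q : 'I_N -> {poly F}) :
  exists Q : {poly F}, forall s, Q.[s] = P.@[fun i => (q i).[s]].
Proof.
exists (\sum_(m <- msupp P) P@_m *: \prod_i q i ^+ m i) => s.
rewrite mevalE horner_sum; apply: eq_bigr => m _; rewrite hornerZ horner_prod.
by congr (_ * _); apply: eq_bigr => i _; rewrite horner_exp.
Qed.

(** Along the curve, each equation of a closed set containing [A] becomes a polynomial in [s]. At
    [s = 0] exactly the entries with exponent 0 keep their coefficient, the others vanish. *)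
Lemma zariski_closure_monomial_curve (n : nat)
    (A : set ('M[F]_n * 'M[F]_n)) (x y : 'I_n -> 'I_n -> F)
    (m : 'I_n -> 'I_n -> nat) :
  let curve s := (\matrix_(k, l) (x k l * s ^+ m k l),
                  \matrix_(k, l) (y k l * s ^+ m k l)) in
  (forall s, s != 0 -> A (curve s)) -> zariski_closure A (curve 0).
Proof.
move=> curve Acurve Z [[S ->] /= AZ] P SP.
have ex i : exists q : {poly F}, forall s, pair_coords (curve s) i = q.[s].
  rewrite /pair_coords; case: (split_ordP i) => j ->.
    case/mxvec_indexP: j => k l; exists (x k l *: 'X^(m k l)) => s.
    by rewrite row_mxEl mxvecE mxE hornerZ hornerXn.
  case/mxvec_indexP: j => k l; exists (y k l *: 'X^(m k l)) => s.
  by rewrite row_mxEr mxvecE mxE hornerZ hornerXn.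
have [q qE] := fin_all_exists ex.
have [Q QE] := meval_poly P q.
have evalE s : P.@[pair_coords (curve s)] = Q.[s].
  by rewrite QE; apply: meval_eq => i.
rewrite evalE (@poly_eq0_off_origin Q) ?horner0 // => s /Acurve/AZ/(_ P SP).
by rewrite evalE.
Qed.

End MonomialCurve.

(** * The diagram and its graded operators *)

Section Diagram.
Variables (n : nat) (mu : seq nat).
Hypothesis hmu : is_partition n mu.

Lemma mem_boxes i j :
  ((i, j) \in boxes mu) = (i < size mu)%N && (j < nth 0%N mu i)%N.
Proof.
apply/allpairsPdep/andP => [[i' [j' [ii jj [-> ->]]]]|[ii jj]].
  by move: ii jj; rewrite !mem_iota.
by exists i, j; rewrite !mem_iota.
Qed.

Lemma uniq_boxes : uniq (boxes mu).
Proof.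
apply: allpairs_uniq_dep => [|x _|]; rewrite ?iota_uniq //.
by move=> [x1 x2] [y1 y2] _ _ /= [-> ->].
Qed.

Lemma size_boxes : size (boxes mu) = n.
Proof.
case/and3P: hmu => _ _ /eqP <-; rewrite /boxes size_allpairs_dep.
rewrite -[in RHS](mkseq_nth 0%N mu); congr sumn.
by apply: eq_map => i; rewrite size_iota.
Qed.

Lemma box_inj : injective (fun k : 'I_n => box mu k).
Proof.
move=> k l /eqP; rewrite nth_uniq ?size_boxes ?uniq_boxes //.
by move=> /eqP; exact: val_inj.
Qed.

Lemma boxP u : reflect (exists k : 'I_n, box mu k = u) (u \in boxes mu).
Proof.
apply: (iffP idP) => [/(nthP (0%N, 0%N))[k]|[k <-]].
  by rewrite size_boxes => kn <-; exists (Ordinal kn).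
by rewrite mem_nth // size_boxes.
Qed.

(** This is where the weakly decreasing order of the parts enters. *)
Lemma boxes_down_closed u v : lebox u v -> v \in boxes mu -> u \in boxes mu.
Proof.
case: u v => [i j] [k l] /andP[/= ik jl]; rewrite !mem_boxes => /andP[ks ln].
have si := leq_ltn_trans ik ks; rewrite si /=.
apply: leq_ltn_trans jl (leq_trans ln _).
case/and3P: hmu => mu_sorted _ _.
have geq_trans : transitive geq by move=> x y z /= xy yz; apply: leq_trans xy.
exact: (sorted_leq_nth geq_trans leqnn 0%N mu_sorted).
Qed.

End Diagram.

Section GradedPairs.
Variables (F : fieldType) (charF : [pchar F] =i pred0) (n : nat) (mu : seq nat).
Hypothesis hmu : is_partition n mu.
Implicit Types (k l : 'I_n) (x y : 'M[F]_n).

Lemma bracket_traceless_diag (d : 'rV[F]_n) x k l :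
  bracket (traceless (diag_mx d)) x k l = (d 0 k - d 0 l) * x k l.
Proof.
rewrite /bracket /traceless mulmxBl mulmxBr mul_scalar_mx mul_mx_scalar.
by rewrite mul_diag_mx mul_mx_diag !mxE; ring.
Qed.

(** Bracketing with [h1] or [h2] scales entry [(k, l)] by a difference of box coordinates, the
    scalar part of [traceless] dropping out; apart from the trace, only the support of [x] is
    constrained. *)
Lemma sl_gradedP (p q : F) x :
  sl_graded F n mu p q x <->
  \tr x = 0 /\ forall k l, x k l != 0 ->
    (box mu k).1%:R = (box mu l).1%:R + p /\
    (box mu k).2%:R = (box mu l).2%:R + q.
Proof.
split=> [[trx x1 x2]|[trx xE]].
  split=> // k l xkl; split; apply/eqP; rewrite addrC -subr_eq; apply/eqP.
    move/matrixP/(_ k l): x1; rewrite bracket_traceless_diag !mxE.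
    exact: (mulIf xkl).
  move/matrixP/(_ k l): x2; rewrite bracket_traceless_diag !mxE.
  exact: (mulIf xkl).
split=> //; apply/matrixP => k l; rewrite bracket_traceless_diag !mxE;
  have [->|/xE[e1 e2]] := eqVneq (x k l) 0; rewrite ?mulr0 //.
  by rewrite e1 addrC addKr.
by rewrite e2 addrC addKr.
Qed.

Lemma sl_graded_down x k l : sl_graded F n mu 1 0 x -> x k l != 0 ->
  box mu k = ((box mu l).1.+1, (box mu l).2).
Proof.
case/sl_gradedP=> _ xE /xE[]; rewrite addr0 natr1.
by case: (box mu k) => i j /= /(natr_inj_char0 charF)-> /(natr_inj_char0 charF)->.
Qed.

Lemma sl_graded_right x k l : sl_graded F n mu 0 1 x -> x k l != 0 ->
  box mu k = ((box mu l).1, (box mu l).2.+1).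
Proof.
case/sl_gradedP=> _ xE /xE[]; rewrite addr0 natr1.
by case: (box mu k) => i j /= /(natr_inj_char0 charF)-> /(natr_inj_char0 charF)->.
Qed.

Lemma e1E k l :
  e1 F n mu k l = (box mu k == ((box mu l).1.+1, (box mu l).2))%:R.
Proof. by rewrite !mxE. Qed.

Lemma e2E k l :
  e2 F n mu k l = (box mu k == ((box mu l).1, (box mu l).2.+1))%:R.
Proof. by rewrite !mxE. Qed.

Lemma trace_e1 : \tr (e1 F n mu) = 0.
Proof.
rewrite /mxtrace big1 // => k _; rewrite e1E.
by case: eqP => // /(congr1 fst) /= ?; lia.
Qed.

Lemma trace_e2 : \tr (e2 F n mu) = 0.
Proof.
rewrite /mxtrace big1 // => k _; rewrite e2E.
by case: eqP => // /(congr1 snd) /= ?; lia.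
Qed.

(** Both products move a box one step diagonally. If the target is in the diagram, so are the two
    intermediate boxes, and each sum has a single nonzero term. *)
Lemma e1_e2_comm : e1 F n mu *m e2 F n mu = e2 F n mu *m e1 F n mu.
Proof.
have sumE (h : 'I_n -> bool) m k : h =1 (fun l => (l == m) && h m) ->
    \sum_l (h l)%:R = (h m)%:R :> F.
  move=> hE; rewrite (bigD1 m) //= big1 ?addr0 // => l /negPf lm.
  by rewrite hE lm.
apply/matrixP => k l; rewrite !mxE.
case: (boolP (box mu k == ((box mu l).1.+1, (box mu l).2.+1))) => kl; last first.
  rewrite !big1 // => m _; rewrite e1E e2E -natrM mulnb.
    case: andP => // -[/eqP km /eqP ml].
    by move: kl; rewrite km ml eqxx.
  case: andP => // -[/eqP km /eqP ml].
  by move: kl; rewrite km ml eqxx.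
have kD : ((box mu l).1.+1, (box mu l).2.+1) \in boxes mu.
  by apply/(boxP hmu); exists k; apply/eqP.
have /(boxP hmu)[m1 m1E] : ((box mu l).1.+1, (box mu l).2) \in boxes mu.
  by apply: (boxes_down_closed hmu _ kD); rewrite /lebox /= leqnn leqnSn.
have /(boxP hmu)[m2 m2E] : ((box mu l).1, (box mu l).2.+1) \in boxes mu.
  by apply: (boxes_down_closed hmu _ kD); rewrite /lebox /= leqnn leqnSn.
rewrite (bigD1 m2) //= [RHS](bigD1 m1) //= !big1.
- by rewrite !e1E !e2E m1E m2E /= kl !eqxx.
- move=> m; rewrite e1E e2E -natrM mulnb => /eqP mm.
  case: andP => // -[_ /eqP me].
  by case: mm; apply: (box_inj hmu); rewrite me m1E.
move=> m; rewrite e1E e2E -natrM mulnb => /eqP mm; case: andP => // -[_ /eqP me].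
by case: mm; apply: (box_inj hmu); rewrite me m2E.
Qed.

Lemma torus_orbit_graded :
  torus_orbit (nilpair F n mu) `<=`
    (sl_graded F n mu 1 0 `*` sl_graded F n mu 0 1) `&` commuting_variety F n.
Proof.
move=> _ [t [/diag_mxP[d tE] dett] <-].
have tu : t \in unitmx by rewrite unitmxE dett unitr1.
have trJ x : \tr (t *m x *m invmx t) = \tr x.
  by rewrite mxtrace_mulC mulmxA mulVmx // mul1mx.
have mulJ x y :
    t *m x *m invmx t *m (t *m y *m invmx t) = t *m (x *m y) *m invmx t.
  by rewrite !mulmxA mulmxKV.
(* Conjugation by an invertible diagonal matrix only rescales entries; multiplying back by
   [diag_mx d] avoids computing the inverse. *)
have suppJ x k l : (t *m x *m invmx t) k l != 0 -> x k l != 0.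
  have : t *m x *m invmx t *m diag_mx d = diag_mx d *m x by rewrite -tE mulmxKV.
  move: (_ *m invmx t) => z /matrixP/(_ k l) zE.
  apply: contraNN => /eqP x0; move: zE.
  have dl : d 0 l != 0.
    have : \prod_i d 0 i != 0 by rewrite -det_diag -tE dett oner_eq0.
    by move/prodf_neq0; apply.
  rewrite mul_mx_diag mul_diag_mx !mxE x0 mulr0 => /eqP.
  by rewrite mulf_eq0 (negPf dl) orbF.
split; split; rewrite /conj_pair /=.
- apply/sl_gradedP; split=> [|k l /suppJ]; first by rewrite trJ trace_e1.
  by rewrite e1E; case: (box mu k =P _) => [->|]; rewrite ?eqxx //= natr1 addr0.
- apply/sl_gradedP; split=> [|k l /suppJ]; first by rewrite trJ trace_e2.
  by rewrite e2E; case: (box mu k =P _) => [->|]; rewrite ?eqxx //= natr1 addr0.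
- by rewrite /sl /= trJ trace_e1.
- by rewrite /sl /= trJ trace_e2.
by rewrite /bracket !mulJ e1_e2_comm subrr.
Qed.

(** Entries are extended by 0 outside the diagram, because the grid arguments need scalars on all of
    the quadrant. *)
Definition box_entry x (u v : nat * nat) : F :=
  if [pick k : 'I_n | box mu k == u] is Some k then
    if [pick l : 'I_n | box mu l == v] is Some l then x k l else 0
  else 0.

Lemma box_entryE x k l : box_entry x (box mu k) (box mu l) = x k l.
Proof.
rewrite /box_entry.
case: pickP => [k' /eqP/(box_inj hmu)->|/(_ k)]; last by rewrite eqxx.
by case: pickP => [l' /eqP/(box_inj hmu)->|/(_ l)] //; rewrite eqxx.
Qed.

Lemma box_entry_out x u v : u \notin boxes mu -> box_entry x u v = 0.
Proof.
move=> uD; rewrite /box_entry; case: pickP => // k /eqP ku.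
by case/negP: uD; apply/(boxP hmu); exists k.
Qed.

(** If the far corner is outside the diagram, both sides have a zero factor. Otherwise the whole
    square is inside, and this is one entry of [x *m y = y *m x], where the grading leaves one term
    in each sum. *)
Lemma box_entry_grid_comm x y i j :
    sl_graded F n mu 1 0 x -> sl_graded F n mu 0 1 y -> x *m y = y *m x ->
  box_entry x (i.+1, j) (i, j) * box_entry y (i.+1, j.+1) (i.+1, j) =
  box_entry y (i, j.+1) (i, j) * box_entry x (i.+1, j.+1) (i, j.+1).
Proof.
move=> gx gy xy.
have [kD|kD] := boolP ((i.+1, j.+1) \in boxes mu); last first.
  by rewrite !(box_entry_out _ _ kD) !mulr0.
have /(boxP hmu)[l lE] : (i, j) \in boxes mu.
  by apply: (boxes_down_closed hmu _ kD); rewrite /lebox /= !leqnSn.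
have /(boxP hmu)[m1 m1E] : (i.+1, j) \in boxes mu.
  by apply: (boxes_down_closed hmu _ kD); rewrite /lebox /= leqnn leqnSn.
have /(boxP hmu)[m2 m2E] : (i, j.+1) \in boxes mu.
  by apply: (boxes_down_closed hmu _ kD); rewrite /lebox /= leqnn leqnSn.
have /(boxP hmu)[k kE] := kD.
rewrite -lE -m1E -m2E -kE !box_entryE.
move/matrixP/(_ k l): xy; rewrite !mxE (bigD1 m2) //= [RHS](bigD1 m1) //= !big1.
- by rewrite !addr0 => e; rewrite mulrC -e mulrC.
- move=> m /eqP mm; have [->|/(sl_graded_down gx) mE] := eqVneq (x m l) 0.
    by rewrite mulr0.
  by case: mm; apply: (box_inj hmu); rewrite m1E mE lE.
move=> m /eqP mm; have [->|/(sl_graded_right gy) mE] := eqVneq (y m l) 0.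
  by rewrite mulr0.
by case: mm; apply: (box_inj hmu); rewrite m2E mE lE.
Qed.

End GradedPairs.

(** * Density of the torus orbit *)

Lemma exists_nth_root (F : closedFieldType) (n : nat) (c : F) :
  (0 < n)%N -> exists r : F, r ^+ n = c.
Proof.
move=> n_gt0; have [|r /rootP rE] := closed_rootP ('X^n - c%:P : {poly F}) _.
  by rewrite size_XnsubC // eqSS -lt0n.
exists r; apply/eqP; rewrite -subr_eq0.
by rewrite !hornerE in rE; rewrite rE.
Qed.

Theorem theorem8p1p1 (F : closedFieldType) (charF : [pchar F] =i pred0)
    (n : nat) (mu : seq nat) (hmu : is_partition n mu) :
  zariski_dense_in
    (torus_orbit (nilpair F n mu))
    ((sl_graded F n mu 1 0 `*` sl_graded F n mu 0 1)
       `&` commuting_variety F n).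
Proof.
split; first exact: torus_orbit_graded.
move=> [x y] [[/= gx gy] [_ _ /= /subr0_eq xy]].
pose a i j := box_entry mu x (i.+1, j) (i, j).
pose b i j := box_entry mu y (i, j.+1) (i, j).
have ab i j : a i j * b i.+1 j = b i j * a i j.+1 by exact: box_entry_grid_comm.
have [g [phi [g0 gphi]]] := exists_degeneration ab (fun k : 'I_n => box mu k).
(* The truncated subtraction is harmless: wherever [e1] or [e2] has a nonzero entry [(k, l)], box
   [k] covers box [l] and [phi l <= phi k]. *)
pose m k l := (phi k - phi l)%N.
pose curve s := (\matrix_(k, l) (e1 F n mu k l * (g k / g l) * s ^+ m k l),
                 \matrix_(k, l) (e2 F n mu k l * (g k / g l) * s ^+ m k l)).
have entryE s k l : s * g l = g k * 0 ^+ m k l -> s = g k / g l * 0 ^+ m k l.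
  by move=> e; rewrite mulrAC -e mulfK.
have -> : (x, y) = curve 0.
  congr pair; apply/matrixP => k l; rewrite mxE.
    rewrite e1E; case: eqP => [kl|kl]; last first.
      rewrite !mul0r; apply/eqP/negPn/negP => /(sl_graded_down charF gx) ?.
      by case: kl.
    have lk : covers (fun k : 'I_n => box mu k) l k by rewrite /covers kl eqxx.
    rewrite mul1r; apply: entryE; have [_ <-] := gphi _ _ lk.
    rewrite /weight kl [box mu l]surjective_pairing transport_down /a.
    by rewrite -surjective_pairing -kl box_entryE.
  rewrite e2E; case: eqP => [kl|kl]; last first.
    rewrite !mul0r; apply/eqP/negPn/negP => /(sl_graded_right charF gy) ?.
    by case: kl.
  have lk : covers (fun k : 'I_n => box mu k) l k by rewrite /covers kl eqxx orbT.
  rewrite mul1r; apply: entryE; have [_ <-] := gphi _ _ lk.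
  rewrite /weight kl [box mu l]surjective_pairing transport_right /b.
  by rewrite -surjective_pairing -kl box_entryE.
apply: (zariski_closure_monomial_curve charF
  (x := fun k l => e1 F n mu k l * (g k / g l))
  (y := fun k l => e2 F n mu k l * (g k / g l)) (m := m)) => s s0.
pose D := \prod_k (g k * s ^+ phi k).
have D0 : D != 0.
  by apply/prodf_neq0 => k _; rewrite mulf_neq0 ?expf_neq0.
(* The scalar [c] normalises the determinant to 1 and disappears under conjugation. For [n = 0] the
   product [D] is empty and [c = 1] works. *)
have [c cE] : exists c : F, c ^+ n * D = 1.
  case: (posnP n) => [n0|/(exists_nth_root D^-1)[c cE]]; last first.
    by exists c; rewrite cE mulVf.
  exists 1; rewrite expr1n mul1r /D big1 // => k; have := ltn_ord k.
  by rewrite {2}n0.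
pose d : 'rV[F]_n := \row_k (c * (g k * s ^+ phi k)).
have detd : \det (diag_mx d) = 1.
  rewrite det_diag -[RHS]cE /D -[n in c ^+ n]card_ord -prodr_const -big_split /=.
  by apply: eq_bigr => k _; rewrite mxE.
have du : diag_mx d \in unitmx by rewrite unitmxE detd unitr1.
exists (diag_mx d); first by split; rewrite ?diag_mx_is_diag.
(* Conjugation scales entry [(k, l)] by the quotient of the diagonal entries [k] and [l], here
   [g k / g l * s ^+ m k l]; it is checked as [diag_mx d *m e = z *m diag_mx d]. *)
have conjE (e z : 'M[F]_n) : (forall k l, e k l != 0 -> (phi l <= phi k)%N) ->
    (forall k l, z k l = e k l * (g k / g l) * s ^+ m k l) ->
    diag_mx d *m e *m invmx (diag_mx d) = z.
  move=> eE zE; rewrite -[RHS](mulmxK du); congr (_ *m _).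
  apply/matrixP => k l; rewrite mul_diag_mx mul_mx_diag !mxE zE.
  have [->|/eE le] := eqVneq (e k l) 0; first by rewrite !(mul0r, mulr0).
  rewrite -{1}(subnK le) exprD -/(m k l); field.
  exact: g0.
rewrite /conj_pair /curve /=; congr pair; apply: conjE => k l; rewrite ?mxE //.
  case: (box mu k =P _) => [kl _|]; rewrite ?eqxx //.
  by have [] := gphi l k _; rewrite // /covers kl eqxx.
case: (box mu k =P _) => [kl _|]; rewrite ?eqxx //.
by have [] := gphi l k _; rewrite // /covers kl eqxx orbT.
Qed.
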